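(* Let $\mathcal{X}$ be a Borel space. The following two assertions are equivalent. (i) For every $\mathcal{X}$-valued exchangeable array $X=(X_{\mathbf{i}})_{\mathbf{i}\in\mathbb{N}^*_{\neq}}$ there exists a measurable function $f:\bigcup_{k\geq 0}[0,1]^{2^{[k]}}\to\mathcal{X}$ such that $$X\overset{d}{=}\Big(f\big((U_{\pi_{\mathbf{i}}(e)})_{e\in 2^{[k]}}\big)\Big)_{\mathbf{i}=(i_1,\dots,i_k)\in\mathbb{N}^*_{\neq}},$$ where $(U_a)$, $a$ ranging over the finite subsets of $\mathbb{N}$, are i.i.d. uniform on $[0,1]$ and, for $\mathbf{i}=(i_1,\dots,i_k)$, $\pi_{\mathbf{i}}:\{1,\dots,k\}\to\{i_1,\dots,i_k\}$, $j\mapsto i_j$ (and $\pi_{\mathbf i}(e)$ denotes the image of $e\subseteq[k]$). (ii) For every exchangeable law $\mu\in\mathrm{SYM}(\mathrm{ARRAY}(\mathcal{X},\square^*_{\neq}))$ there exists a natural transformation $\eta:R\to\mathrm{ARRAY}(\mathcal{X},\square^*_{\neq})$ such that $\mu=\mathrm{unif}(R)\circ\eta^{-1}$.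
   Context: $[k]=\{1,\dots,k\}$, $[0]=\emptyset$; $2^M$ is the power set of $M$. $M^*_{\neq}$ is the set of all finite-length tuples $(m_1,\dots,m_k)$, $k\ge 0$, of elements of $M$ with pairwise distinct entries. $\overset{d}{=}$ is equality in distribution. A family of $\mathcal{X}$-valued random variables $(X_{\mathbf{i}})_{\mathbf{i}\in\mathbb{N}^*_{\neq}}$ is exchangeable if $(X_{\pi\mathbf{i}})_{\mathbf{i}}\overset{d}{=}(X_{\mathbf{i}})_{\mathbf{i}}$ for every bijection $\pi:\mathbb{N}\to\mathbb{N}$, with $\pi(i_1,\dots,i_k)=(\pi(i_1),\dots,\pi(i_k))$. A Borel space is a measurable space admitting a bi-measurable bijection onto a Borel subset of $[0,1]$. A Borel data structure (BDS) $D$ is a rule mapping every finite set $a$ to a Borel space $D_a$ and every injection $\tau:b\to a$ between finite sets to a measurable map $D[\tau]:D_a\to D_b$, with $D[\mathrm{id}_a]=\mathrm{id}_{D_a}$ and $D[\sigma\circ\tau]=D[\tau]\circ D[\sigma]$. (''Rules'' on all finite sets: NBG with global choice, or inside a fixed Grothendieck universe.) An exchangeable law $\mu\in\mathrm{SYM}(D)$ is a rule sending every finite set $a$ to a probability measure $\mu_a$ on $D_a$ with $\mu_a\circ D[\tau]^{-1}=\mu_b$ for every injection $\tau:b\to a$. A natural transformation $\eta:D\to E$ between BDS is a rule sending every finite set $a$ to a measurable map $\eta_a:D_a\to E_a$ with $\eta_b\circ D[\tau]=E[\tau]\circ\eta_a$ for every injection $\tau:b\to a$. $\mu\circ\eta^{-1}$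 is the rule $a\mapsto\mu_a\circ\eta_a^{-1}$. $\mathrm{ARRAY}(\mathcal{X},\square^*_{\neq})$ is the BDS with $D_a=\mathcal{X}^{a^*_{\neq}}$ and $D[\tau](x)=x\circ\vec\tau$, where $\vec\tau(i_1,\dots,i_k)=(\tau(i_1),\dots,\tau(i_k))$. $R$ is the BDS with $R_a=[0,1]^{2^a}$ and $R[\tau](u)=u\circ\mathrm{im}(\tau)$, where $\mathrm{im}(\tau)(b')=\tau(b')$ for $b'\subseteq b$. $\mathrm{unif}(R)\in\mathrm{SYM}(R)$ is $\mathrm{unif}(R)_a=\mathrm{unif}[0,1]^{\otimes 2^a}$. *)

(* Defs.v *)
From HB Require Import structures.
From mathcomp Require Import all_boot all_order all_algebra finmap.
From mathcomp Require Import all_classical all_reals all_analysis.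
From mathcomp Require Import measurable_realfun lra.
Import Order.TTheory GRing.Theory Num.Theory.
Import numFieldNormedType.Exports.

Set Implicit Arguments.
Unset Strict Implicit.
Unset Printing Implicit Defensive.

Local Open Scope classical_set_scope.
Local Open Scope ring_scope.

Definition product_display : measure_display -> measure_display.
Proof. exact. Qed.

(* T^I with the product sigma-algebra *)
Definition mprod (I T : Type) : Type := I -> T.

Definition cylinders (I : Type) d (T : measurableType d) :
    set (set (mprod I T)) :=
  [set C | exists i, exists2 B, measurable B & C = [set x | B (x i)]].

Section mprod_measurable.
Context (I : Type) d (T : measurableType d).

HB.instance Definition _ := Pointed.copy (mprod I T) (forall _ : I, T).
HB.instance Definition _ := @isMeasurable.Build (product_display d) (mprod I T)
  <<s @cylinders I d T >> (@sigma_algebra0 _ setT (@cylinders I d T))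
  (@sigma_algebraC (mprod I T) (@cylinders I d T))
  (@sigma_algebra_bigcup _ setT (@cylinders I d T)).

Lemma measurable_coord (i : I) :
  measurable_fun [set: mprod I T] (fun x : mprod I T => x i).
Proof.
move=> _ B mB; rewrite setTI; apply: sub_sigma_algebra.
by exists i, B.
Qed.

Lemma measurable_mprodP d' (S : measurableType d') (f : S -> mprod I T) :
  (forall i, measurable_fun [set: S] (fun s => f s i)) ->
  measurable_fun [set: S] f.
Proof.
move=> mf; apply: (measurability (@cylinders I d T)) => //.
move=> _ [_ [i [B mB ->]] <-].
exact: mf.
Qed.

End mprod_measurable.

Lemma measurable_mprod_comp (I J : Type) d (T : measurableType d) (s : J -> I) :
  measurable_fun [set: mprod I T] (fun x : mprod I T => (x \o s : mprod J T)).
Proof. by apply: measurable_mprodP => j; exact: measurable_coord. Qed.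

(* disjoint union of the T i, with the largest sigma-algebra making the
   injections measurable *)
Definition mdsum (I : choiceType) d (T : I -> measurableType d) : Type :=
  {i : I & T i}.

Section mdsum_measurable.
Context (I : pointedType) d (T : I -> measurableType d).

Definition mdsum_sets : set (set (mdsum T)) :=
  [set A | forall i, measurable [set x : T i | A (existT _ i x)]].

Lemma mdsum_sets0 : mdsum_sets set0.
Proof. by move=> i; exact: measurable0. Qed.

Lemma mdsum_setsC A : mdsum_sets A -> mdsum_sets (~` A).
Proof. by move=> mA i; exact: measurableC (mA i). Qed.

Lemma mdsum_sets_bigcup (F : (set (mdsum T))^nat) :
  (forall i, mdsum_sets (F i)) -> mdsum_sets (\bigcup_i (F i)).
Proof.
by move=> mF i; apply: (@bigcupT_measurable _ (T i)
  (fun k => [set x | F k (existT _ i x)])) => k; exact: mF.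
Qed.

HB.instance Definition _ := Choice.copy (mdsum T) {i : I & T i}.
HB.instance Definition _ :=
  isPointed.Build (mdsum T) (existT (fun i => T i) point point).
HB.instance Definition _ := @isMeasurable.Build d (mdsum T)
  mdsum_sets mdsum_sets0 mdsum_setsC mdsum_sets_bigcup.

Lemma measurable_mdsumP d' (S : measurableType d') (f : mdsum T -> S) :
  measurable_fun [set: mdsum T] f <->
  forall i, measurable_fun [set: T i] (fun x => f (existT _ i x)).
Proof.
split=> [mf i _ B mB|mf _ B mB]; rewrite setTI.
  by have := mf measurableT B mB; rewrite setTI; apply.
by move=> i; have := mf i measurableT B mB; rewrite setTI.
Qed.

End mdsum_measurable.

Definition unit_itv (R : realType) := {x : R | 0 <= x <= 1}.

Section unit_itv_measurable.
Context (R : realType).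
Local Notation vali := (val : unit_itv R -> R).

Let pointP : (0 : R) <= (0 : R) <= 1. Proof. by rewrite lexx ler01. Qed.

HB.instance Definition _ := SubChoice.on (unit_itv R).
HB.instance Definition _ := isPointed.Build (unit_itv R) (exist _ 0 pointP).

Definition unit_sets : set (set (unit_itv R)) :=
  preimage_set_system setT vali measurable.

Lemma unit_sigma_algebra : sigma_algebra setT unit_sets.
Proof. exact/sigma_algebra_preimage/sigma_algebra_measurable. Qed.

Lemma unit_sets0 : unit_sets set0.
Proof. by case: unit_sigma_algebra. Qed.

Lemma unit_setsC A : unit_sets A -> unit_sets (~` A).
Proof. by case: unit_sigma_algebra => _ + _ => /[apply]; rewrite setTD. Qed.

Lemma unit_sets_bigcup (F : (set (unit_itv R))^nat) :
  (forall i, unit_sets (F i)) -> unit_sets (\bigcup_i (F i)).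
Proof. by case: unit_sigma_algebra => _ _ /[apply]. Qed.

HB.instance Definition _ := @isMeasurable.Build (preimage_display vali)
  (unit_itv R) unit_sets unit_sets0 unit_setsC unit_sets_bigcup.

Lemma measurable_unit_val : measurable_fun [set: unit_itv R] vali.
Proof. by move=> _ B mB; exists B. Qed.

Lemma measurable_unitP d (S : measurableType d) (f : S -> unit_itv R) :
  measurable_fun [set: S] (fun s => val (f s)) -> measurable_fun [set: S] f.
Proof.
move=> mf _ _ [B mB <-]; rewrite setTI.
by have := mf measurableT B mB; rewrite !setTI.
Qed.

Lemma measurable_unit_image (A : set (unit_itv R)) :
  measurable A -> measurable (vali @` A).
Proof.
move=> [B mB <-]; rewrite (_ : _ @` _ = B `&` `[0, 1]%classic).
  by apply: measurableI => //; exact: measurable_itv.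
rewrite setTI; apply/seteqP; split => [_ [x Bx <-]|x [Bx]].
  by split => //=; rewrite in_itv/=; exact: (valP x).
by rewrite /= in_itv/= => x01; exists (exist _ x x01).
Qed.

Definition unif01 (A : set (unit_itv R)) : \bar R :=
  lebesgue_measure (vali @` A).

Lemma unif01_set0 : unif01 set0 = 0%E.
Proof. by rewrite /unif01 image_set0 measure0. Qed.

Lemma unif01_ge0 A : (0 <= unif01 A)%E. Proof. exact: measure_ge0. Qed.

Lemma unif01_sigma_additive : semi_sigma_additive unif01.
Proof.
move=> F mF tF mUF; rewrite /unif01 image_bigcup.
apply: measure_semi_sigma_additive.
- by move=> i; exact: measurable_unit_image.
- apply/trivIsetP => i j _ _ ij; apply/seteqP; split => // _ [[x Fix <-]].
  case=> y Fjy /val_inj yx; rewrite {}yx in Fjy.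
  by move/trivIsetP : tF => /(_ i j I I ij) /seteqP[/(_ x) + _]; apply.
- by rewrite -image_bigcup; exact: measurable_unit_image.
Qed.

HB.instance Definition _ :=
  isMeasure.Build _ _ _ unif01 unif01_set0 unif01_ge0 unif01_sigma_additive.

Lemma unif01_setT : unif01 setT = 1%E.
Proof.
rewrite /unif01 (_ : _ @` _ = `[0, 1]%classic).
  by rewrite lebesgue_measure_itv/= lte_fin ltr01 sube0.
apply/seteqP; split => [_ [x _ <-]|x].
  by rewrite /= in_itv/=; exact: (valP x).
by rewrite /= in_itv/= => x01; exists (exist _ x x01).
Qed.

HB.instance Definition _ :=
  Measure_isProbability.Build _ _ _ unif01 unif01_setT.

End unit_itv_measurable.

(* taking A = setT, the range of phi is a Borel subset of [0, 1] *)
Definition borel_space (R : realType) d (T : measurableType d) : Prop :=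
  exists phi : T -> unit_itv R, [/\ injective phi,
    measurable_fun [set: T] phi &
    forall A, measurable A -> measurable (phi @` A)].

(* Since measurable types are pointed, a space is Borel iff it is a measurable
   retract of [0, 1]; this form is stable under countable products. *)
Definition retract d1 d2 (S : measurableType d1) (T : measurableType d2) :
    Prop :=
  exists (f : S -> T) (g : T -> S),
    [/\ measurable_fun [set: S] f, measurable_fun [set: T] g & cancel f g].

Lemma retract_trans d1 d2 d3 (S : measurableType d1) (T : measurableType d2)
    (V : measurableType d3) : retract S T -> retract T V -> retract S V.
Proof.
move=> [f [g [mf mg fg]]] [f' [g' [mf' mg' fg']]].
exists (f' \o f), (g \o g'); split; try exact: measurableT_comp.
by move=> x /=; rewrite fg' fg.
Qed.

Lemma retract_mprod (I : Type) d1 d2 (S : measurableType d1)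
    (T : measurableType d2) : retract S T -> retract (mprod I S) (mprod I T).
Proof.
move=> [f [g [mf mg fg]]].
exists (fun x i => f (x i)), (fun x i => g (x i)); split.
- apply: measurable_mprodP => i.
  exact: (measurableT_comp mf (@measurable_coord I _ S i)).
- apply: measurable_mprodP => i.
  exact: (measurableT_comp mg (@measurable_coord I _ T i)).
- by move=> x; apply/funext => i; rewrite fg.
Qed.

Lemma retract_reindex (I J : Type) d (T : measurableType d) (e : I -> J)
    (e' : J -> option I) : pcancel e e' -> retract (mprod I T) (mprod J T).
Proof.
move=> ee'; exists (fun x j => if e' j is Some i then x i else point),
  (fun x i => x (e i)); split.
- apply: measurable_mprodP => j; case: (e' j) => [i|].
    exact: measurable_coord.
  exact: measurable_cst.
- by apply: measurable_mprodP => i; exact: measurable_coord.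
- by move=> x; apply/funext => i; rewrite ee'.
Qed.

Lemma retract_curry (I J : Type) d (T : measurableType d) :
  retract (mprod I (mprod J T)) (mprod (I * J) T).
Proof.
exists (fun x p => x p.1 p.2), (fun x i j => x (i, j)); split => //.
- apply: measurable_mprodP => -[i j] /=.
  exact: (measurableT_comp (@measurable_coord J _ T j)
                           (@measurable_coord I _ (mprod J T) i)).
- apply: measurable_mprodP => i; apply: measurable_mprodP => j.
  exact: measurable_coord.
Qed.

Section borel_retract.
Context (R : realType).

Lemma borel_spaceP d (T : measurableType d) :
  borel_space R T <-> retract T (unit_itv R).
Proof.
split=> [[phi [iphi mphi imphi]]|[f [g [mf mg fg]]]].
  exists phi, (fun y => xget point [set x | phi x = y]).
  split => //; last first.
    by move=> x; case: xgetP => [y _ /= /iphi //|nx]; case: (nx x).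
  move=> _ A mA; rewrite setTI.
  have mr : measurable (~` range phi) by exact/measurableC/imphi.
  have -> : (fun y => xget point [set x | phi x = y]) @^-1` A =
      phi @` A `|` (~` range phi `&` [set y | A point]).
    apply/seteqP; split => y /=.
      case: xgetP => [x _ xy Ax|nr Ap]; first by left; exists x.
      by right; split => // -[x _ xy]; case: (nr x).
    case=> [[x Ax <-]|[nr Ap]].
      by case: xgetP => [z _ /= /iphi ->//|nx]; case: (nx x).
    by case: xgetP => // z _ /= zy; exfalso; apply: nr; exists z.
  apply: measurableU; first exact: imphi.
  apply: measurableI => //; have [Ap|nAp] := pselect (A point).
    by rewrite (_ : [set y | _] = setT)//; apply/seteqP; split.
  by rewrite (_ : [set y | _] = set0)//; apply/seteqP; split.
exists f; split => //; first exact: can_inj fg.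
move=> A mA; have -> : f @` A = g @^-1` A `&` [set y | val (f (g y)) = val y].
  apply/seteqP; split => [_ [x Ax <-]|y [Agy /val_inj fgy]] /=.
    by rewrite fg.
  by exists (g y).
apply: measurableI; first by rewrite -[_ @^-1` _]setTI; exact: mg.
have := @measurable_fun_eqr _ _ R setT
  (fun y : unit_itv R => val (f (g y))) (fun y : unit_itv R => val y).
move=> /(_ (measurableT_comp (@measurable_unit_val R) (measurableT_comp mf mg))
           (@measurable_unit_val R) measurableT [set true] Logic.I).
by rewrite setTI; congr measurable; apply/seteqP; split => y /=; move=> /eqP.
Qed.

End borel_retract.

Section cantor_retract.
Context (R : realType).

Let clamp (x : R) : unit_itv R := insubd (point : unit_itv R) x.

Let clampE (x : R) : 0 <= x <= 1 -> val (clamp x) = x.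
Proof. by move=> x01; rewrite val_insubd x01. Qed.

Let measurable_clamp : measurable_fun [set: R] clamp.
Proof.
apply: measurable_unitP; rewrite (_ : (fun s => _) =
    (fun x => if (0 <= x) && (x <= 1) then x else 0)).
  apply: measurable_fun_ifT => //; apply: measurable_and.
  - exact: measurable_fun_ler.
  - exact: measurable_fun_ler.
by apply/funext => x; rewrite val_insubd.
Qed.

Let cutsup (n : nat) (y : mprod rat bool) : R :=
  if choice.unpickle n is Some q then
    (if y q && (0 <= (ratr q : R) <= 1) then ratr q else 0) else 0.

Let cutsup01 n y : 0 <= cutsup n y <= 1.
Proof.
rewrite /cutsup; case: (choice.unpickle n) => [q|]; last by rewrite lexx ler01.
by case: ifPn => [/andP[]//|_]; rewrite lexx ler01.
Qed.

Let cutsup_ub y : has_ubound (range (cutsup ^~ y)).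
Proof. by exists 1 => _ [n _ <-]; case/andP: (cutsup01 n y). Qed.

Lemma retract_unit_cantor : retract (unit_itv R) (mprod rat bool).
Proof.
exists (fun x q => ratr q < val x),
  (fun y => clamp (sups (cutsup ^~ y) 0)); split.
- apply: measurable_mprodP => q; apply: measurable_fun_ltr => //.
  exact: measurable_unit_val.
- apply: measurableT_comp => //; apply: measurable_fun_sups => // n.
  rewrite /cutsup; case: (choice.unpickle n) => [q|//].
  apply: measurable_fun_ifT => //; apply: measurable_and => //.
  exact: measurable_coord.
- move=> x; apply/val_inj.
  set y : mprod rat bool := fun q => _.
  have /andP[x0 x1] := valP x.
  suff -> : sups (cutsup ^~ y) 0 = val x by rewrite clampE// x0 x1.
  have S0 n : cutsup n y <= sups (cutsup ^~ y) 0.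
    by apply: ub_le_sup; [exact/has_ubound_sdrop/cutsup_ub|exists n].
  apply/eqP; rewrite eq_le; apply/andP; split.
    apply: ge_sup; first by exists (cutsup 0 y), 0%N.
    move=> _ [n _ <-]; rewrite /cutsup; case: (choice.unpickle n) => [q|//].
    by case: ifPn => // /andP[/ltW].
  rewrite leNgt; apply/negP => /rat_in_itvoo[q].
  rewrite in_itv/= => /andP[Sq qx].
  have q0 : 0 <= (ratr q : R).
    by apply: le_trans (ltW Sq); apply: le_trans (S0 0%N);
      case/andP: (cutsup01 0%N y).
  have := S0 (choice.pickle q); rewrite /cutsup choice.pickleK /y qx q0 /=.
  by rewrite (le_trans (ltW qx) x1) leNgt Sq.
Qed.

Fixpoint ternary (n : nat) (b : mprod nat bool) : R :=
  if n is m.+1 then (2 * (b 0%N)%:R + ternary m (b \o succn)) / 3 else 0.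

Let ternary01 n b : 0 <= ternary n b <= 1.
Proof.
elim: n b => [|n IH] b /=; first lra.
by move: (IH (b \o succn)); case: (b 0%N) => /=; lra.
Qed.

Let ternary_nd b : nondecreasing_seq (ternary ^~ b).
Proof.
apply/nondecreasing_seqP => n; elim: n b => [|n IH] b.
  by case/andP: (ternary01 1 b).
have := IH (b \o succn); rewrite [ternary n.+2 _]/= [ternary n.+1 b]/=.
by rewrite [ternary n.+1 _]/= => h; lra.
Qed.

Let measurable_ternary n : measurable_fun [set: mprod nat bool] (ternary n).
Proof.
elim: n => [|n IH] /=; first exact: measurable_cst.
apply: measurable_funM => //; apply: measurable_funD; last first.
  exact: (measurableT_comp IH (@measurable_mprod_comp nat nat _ bool succn)).
apply: measurable_funM => //.
rewrite (_ : (fun x => _) = (fun x : mprod nat bool => if x 0%N then 1 else 0)).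
  by apply: measurable_fun_ifT => //; exact: measurable_coord.
by apply/funext => x; case: (x 0%N).
Qed.

Let tern (b : mprod nat bool) : R := limn (ternary ^~ b).

Let cvg_tern b : ternary ^~ b @ \oo --> tern b.
Proof.
apply: nondecreasing_is_cvgn => //.
by exists 1 => _ [n _ <-]; case/andP: (ternary01 n b).
Qed.

Let tern01 b : 0 <= tern b <= 1.
Proof.
apply/andP; split.
  apply: limr_ge; first by apply/cvg_ex; exists (tern b); exact: cvg_tern.
  by apply: nearW => n; case/andP: (ternary01 n b).
apply: limr_le; first by apply/cvg_ex; exists (tern b); exact: cvg_tern.
by apply: nearW => n; case/andP: (ternary01 n b).
Qed.

Let ternS b : tern b = (2 * (b 0%N)%:R + tern (b \o succn)) / 3.
Proof.
apply: (@cvg_unique _ (@Rhausdorff R) (ternary ^~ b @ \oo)).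
  exact: cvg_tern.
suff : (fun n => ternary n.+1 b) @ \oo -->
    (2 * (b 0%N)%:R + tern (b \o succn)) / 3.
  by rewrite (cvg_shiftS (ternary ^~ b)).
apply: cvgM; last exact: cvg_cst.
by apply: cvgD; [exact: cvg_cst|exact: cvg_tern].
Qed.

Let shift (t : R) : R := 3 * t - (if 1 / 2 < t then 2 else 0).

Let measurable_shift : measurable_fun [set: R] shift.
Proof.
apply: measurable_funB; first exact: measurable_funM.
by apply: measurable_fun_ifT => //; exact: measurable_fun_ltr.
Qed.

Let digit b : (1 / 2 < tern b) = b 0%N.
Proof.
by rewrite ternS; have := tern01 (b \o succn); case: (b 0%N) => /= ?;
  [apply/idP|apply/negbTE; rewrite -leNgt]; lra.
Qed.

Let iter_shift n b : iter n shift (tern b) = tern (fun k => b (n + k)%N).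
Proof.
elim: n b => [|n IH] b //; rewrite iterSr /shift digit -/shift.
rewrite (_ : _ - _ = tern (b \o succn)) ?IH//.
by rewrite ternS; case: (b 0%N) => /=; lra.
Qed.

Lemma retract_cantor_unit : retract (mprod nat bool) (unit_itv R).
Proof.
exists (fun b => clamp (tern b)),
  (fun t n => 1 / 2 < iter n shift (val t)); split.
- apply: measurableT_comp => //.
  by apply: (measurable_fun_cvg measurable_ternary) => b _; exact: cvg_tern.
- apply: measurable_mprodP => n; apply: measurable_fun_ltr => //.
  apply: (@measurableT_comp _ _ _ _ _ _ (iter n shift)).
    elim: n => [|n IH]; first exact: measurable_id.
    by rewrite (_ : iter n.+1 shift = shift \o iter n shift)//;
      exact: measurableT_comp.
  exact: measurable_unit_val.
- move=> b; apply/funext => n.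
  by rewrite clampE// iter_shift digit addn0.
Qed.

Lemma borel_unit_itv : borel_space R (unit_itv R).
Proof. by exists id; split => // A mA; rewrite image_id. Qed.

Lemma borel_mprod (I : countType) d (T : measurableType d) :
  borel_space R T -> borel_space R (mprod I T).
Proof.
move=> /borel_spaceP rT; apply/borel_spaceP.
have r1 : retract (mprod I T) (mprod I (mprod rat bool)).
  exact/retract_mprod/(retract_trans rT)/retract_unit_cantor.
apply: (retract_trans r1).
apply: (retract_trans (@retract_curry I rat _ bool)).
apply: retract_trans retract_cantor_unit.
exact: (@retract_reindex (I * rat)%type nat _ _
  choice.pickle choice.unpickle (@choice.pickleK _)).
Qed.

End cantor_retract.

Section product_probability.
Context d (T : measurableType d) (R : realType) (P : probability T R).

Definition mcons n (p : T * mprod 'I_n T) : mprod 'I_n.+1 T :=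
  fun i => if unlift ord0 i is Some j then p.2 j else p.1.

Lemma measurable_mcons n : measurable_fun [set: T * mprod 'I_n T] (@mcons n).
Proof.
apply: measurable_mprodP => i; rewrite /mcons.
case: (unlift ord0 i) => [j|]; last exact: measurable_fst.
exact: (measurableT_comp (@measurable_coord _ _ T j) measurable_snd).
Qed.

HB.instance Definition _ n :=
  isMeasurableFun.Build _ _ _ _ (@mcons n) (@measurable_mcons n).

Fixpoint power_prob_ord n : probability (mprod 'I_n T) R :=
  if n is m.+1 then distribution (P \x power_prob_ord m)%E (@mcons m)
  else \d_(point : mprod 'I_0 T).

Definition of_enum (I : finType) (x : mprod 'I_#|I| T) : mprod I T :=
  x \o enum_rank.

HB.instance Definition _ (I : finType) := isMeasurableFun.Build _ _ _ _
  (@of_enum I) (@measurable_mprod_comp _ _ _ T enum_rank).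

(* the product measure of I copies of P *)
Definition power_prob (I : finType) : probability (mprod I T) R :=
  distribution (power_prob_ord #|I|) (@of_enum I).

Lemma measurable_box (I : finType) (B : I -> set T) :
  (forall i, measurable (B i)) ->
  measurable [set x : mprod I T | forall i, B i (x i)].
Proof.
move=> mB; rewrite (_ : [set x | _] =
    \bigcap_(i in [set: I]) ((fun x : mprod I T => x i) @^-1` B i)).
  apply: fin_bigcap_measurable => // i _.
  by rewrite -[_ @^-1` _]setTI; exact: measurable_coord.
by apply/seteqP; split => x /= Bx => [i _|i]; exact: Bx.
Qed.

Lemma power_prob_box (I : finType) (B : I -> set T) :
  (forall i, measurable (B i)) ->
  power_prob I [set x | forall i, B i (x i)] = (\prod_(i : I) P (B i))%E.
Proof.
move=> mB; rewrite /power_prob /distribution /pushforward /=.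
have ordE n (C : 'I_n -> set T) : (forall i, measurable (C i)) ->
    power_prob_ord n [set x | forall i, C i (x i)] = (\prod_(i < n) P (C i))%E.
  elim: n C => [|n IH] C mC.
    rewrite big_ord0 /= diracE mem_set//=.
    by move=> -[].
  rewrite big_ord_recl -IH; last by move=> i; exact: mC.
  rewrite /= /distribution /pushforward -product_measure1E//.
    congr (_ _); apply/seteqP; split => -[a x] /= h.
      split; first by have := h ord0; rewrite /mcons unlift_none.
      by move=> i; have := h (lift ord0 i); rewrite /mcons liftK.
    move=> i; rewrite /mcons; case: unliftP => [j ->|->]; last exact: h.1.
    exact: h.2.
  by apply: (@measurable_box _ (fun i => C (lift ord0 i))) => i; exact: mC.
transitivity (power_prob_ord #|I| [set x | forall i, B (enum_val i) (x i)]);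
    last first.
  rewrite (ordE _ (fun i => B (enum_val i)))//.
  rewrite (reindex (fun k : 'I_#|I| => enum_val k))//=.
  exact/onW_bij/enum_val_bij.
congr (power_prob_ord _ _); apply/seteqP; split => x /= h i.
  by have := h (enum_val i); rewrite /of_enum /= enum_valK.
by have := h (enum_rank i); rewrite enum_rankK.
Qed.

End product_probability.

Lemma mprod_prob_unique (I : finType) d (T : measurableType d) (R : realType)
    (mu nu : probability (mprod I T) R) :
  (forall B : I -> set T, (forall i, measurable (B i)) ->
    mu [set x | forall i, B i (x i)] = nu [set x | forall i, B i (x i)]) ->
  forall A, measurable A -> mu A = nu A.
Proof.
move=> munu A mA.
pose G : set (set (mprod I T)) := [set C | exists2 B : I -> set T,
  (forall i, measurable (B i)) & C = [set x | forall i, B i (x i)]].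
have GT : G setT.
  by exists (fun=> setT) => //; apply/seteqP; split.
apply: (measure_unique G (fun=> setT)) => //.
- apply/seteqP; split; last first.
    apply: smallest_sub; first exact: sigma_algebra_measurable.
    by move=> _ [B mB ->]; exact: measurable_box.
  apply: smallest_sub; first exact: smallest_sigma_algebra.
  move=> _ [i [B mB ->]]; apply: sub_sigma_algebra.
  exists (fun j => if j == i then B else setT).
    by move=> j; case: ifP.
  apply/seteqP; split => x /= => [Bx j|/(_ i)]; last by rewrite eqxx.
  by case: eqP => // ->.
- move=> _ _ [B mB ->] [C mC ->]; exists (fun i => B i `&` C i).
    by move=> i; exact: measurableI.
  apply/seteqP; split => x /= => [[Bx Cx] i|BCx]; first by split.
  by split => i; case: (BCx i).
- by rewrite bigcup_const.
- by move=> _ [B mB ->]; exact: munu.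
- by move=> _; rewrite (le_lt_trans (probability_le1 _ measurableT))// ltry.
Qed.

Lemma power_prob_reindex d (T : measurableType d) (R : realType)
    (P : probability T R) (I J : finType) (s : J -> I) : injective s ->
  forall A : set (mprod J T), measurable A ->
  power_prob P I [set x : mprod I T | A (x \o s)] = power_prob P J A.
Proof.
move=> inj_s A mA.
pose f : mprod I T -> mprod J T := fun x => x \o s.
pose mf := isMeasurableFun.Build _ _ _ _ f (@measurable_mprod_comp _ _ _ T s).
pose F : {mfun mprod I T >-> mprod J T} := HB.pack f mf.
apply: (@mprod_prob_unique J _ T R (distribution (power_prob P I) F)) => //.
move=> B mB.
rewrite power_prob_box// /distribution /pushforward /=.
pose C i := if [pick j | s j == i] is Some j then B j else setT.
have CE j : C (s j) = B j.
  by rewrite /C; case: pickP => [k /eqP/inj_s ->//|/(_ j)]; rewrite eqxx.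
transitivity (power_prob P I [set x | forall i, C i (x i)]); last first.
  rewrite power_prob_box; last by move=> i; rewrite /C; case: pickP.
  rewrite (bigID (mem (codom s)))/= [X in (_ * X)%E]big1 ?mule1; last first.
    move=> i; rewrite /C; case: pickP => [j /eqP <-|_ _].
      by rewrite codom_f.
    exact: probability_setT.
  under [RHS]eq_bigr do rewrite -CE.
  rewrite (reindex_omap s (fun i => [pick j | s j == i])) /=.
    apply: eq_big => [j|//]; rewrite codom_f/=.
    by case: pickP => [k /eqP/inj_s ->|/(_ j)]; rewrite eqxx.
  move=> i /codomP[j ->]; case: pickP => [k /eqP /= ->//|/(_ j)].
  by rewrite eqxx.
congr (power_prob _ _ _); apply/seteqP; split => x /= h i;
  last by rewrite -CE; exact: h.
rewrite /C; case: pickP => [j /eqP <-|//]; exact: h.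
Qed.

Record borel_data_structure (R : realType) (d : measure_display) := BDS {
  bds_space :> finType -> measurableType d;
  bds_borel : forall a : finType, borel_space R (bds_space a);
  bds_map : forall (b a : finType) (tau : b -> a),
    injective tau -> bds_space a -> bds_space b;
  bds_map_measurable : forall (b a : finType) (tau : b -> a)
      (tau_inj : injective tau),
    measurable_fun [set: bds_space a] (bds_map tau_inj);
  bds_map_id : forall (a : finType) (id_inj : injective (@id a)) x,
    bds_map id_inj x = x;
  bds_map_comp : forall (c b a : finType) (tau : c -> b) (sigma : b -> a)
      (tau_inj : injective tau) (sigma_inj : injective sigma)
      (comp_inj : injective (sigma \o tau)) x,
    bds_map comp_inj x = bds_map tau_inj (bds_map sigma_inj x)
}.

Record exchangeable_law (R : realType) d (D : borel_data_structure R d) :=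
  ExchangeableLaw {
  law_prob :> forall a : finType, probability (D a) R;
  law_invariant : forall (b a : finType) (tau : b -> a)
      (tau_inj : injective tau) (B : set (D b)), measurable B ->
    pushforward (law_prob a) (bds_map tau_inj) B = law_prob b B
}.

Record natural_transformation (R : realType) d d'
    (D : borel_data_structure R d) (E : borel_data_structure R d') :=
  NaturalTransformation {
  nat_fun :> forall a : finType, D a -> E a;
  nat_measurable : forall a : finType, measurable_fun [set: D a] (@nat_fun a);
  nat_natural : forall (b a : finType) (tau : b -> a)
      (tau_inj : injective tau) x,
    nat_fun (bds_map tau_inj x) = bds_map tau_inj (nat_fun x)
}.

(* M^*_{<>}: the finite tuples of pairwise distinct elements of M *)
Definition dtuple (M : eqType) : Type := {s : seq M | uniq s}.

Lemma dtuple_map_uniq (M N : eqType) (tau : M -> N) (tau_inj : injective tau)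
    (i : dtuple M) : uniq (map tau (sval i)).
Proof. by rewrite map_inj_uniq//; exact: svalP i. Qed.

Definition dtuple_map (M N : eqType) (tau : M -> N) (tau_inj : injective tau)
    (i : dtuple M) : dtuple N :=
  exist _ (map tau (sval i)) (dtuple_map_uniq tau_inj i).

Section array_structure.
Context (R : realType) d (X : measurableType d) (X_borel : borel_space R X).

Definition array_map (b a : finType) (tau : b -> a) (tau_inj : injective tau)
  (x : mprod (dtuple a) X) : mprod (dtuple b) X := x \o dtuple_map tau_inj.

Lemma borel_array (a : finType) : borel_space R (mprod (dtuple a) X).
Proof. exact: (@borel_mprod R {s : seq a | uniq s} _ X X_borel). Qed.

Lemma measurable_array_map (b a : finType) (tau : b -> a)
  (tau_inj : injective tau) : measurable_fun setT (array_map tau_inj).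
Proof. exact: measurable_mprod_comp. Qed.

Lemma array_map_id (a : finType) (id_inj : injective (@id a)) x :
  array_map id_inj x = x.
Proof.
apply/funext => i; rewrite /array_map /=; congr x.
by apply: val_inj => /=; rewrite map_id.
Qed.

Lemma array_map_comp (c b a : finType) (tau : c -> b) (sigma : b -> a)
  (tau_inj : injective tau) (sigma_inj : injective sigma)
  (comp_inj : injective (sigma \o tau)) x :
  array_map comp_inj x = array_map tau_inj (array_map sigma_inj x).
Proof.
apply/funext => i; rewrite /array_map /=; congr x.
by apply: val_inj => /=; rewrite map_comp.
Qed.

Definition array_structure : borel_data_structure R (product_display d) :=
  BDS borel_array measurable_array_map array_map_id array_map_comp.

End array_structure.

Section randomization_structure.
Context (R : realType).

Definition rand_map (b a : finType) (tau : b -> a) (tau_inj : injective tau)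
  (u : mprod {set a} (unit_itv R)) : mprod {set b} (unit_itv R) :=
  fun e => u [set tau j | j in e]%SET.

Lemma borel_rand (a : finType) : borel_space R (mprod {set a} (unit_itv R)).
Proof. exact/borel_mprod/borel_unit_itv. Qed.

Lemma measurable_rand_map (b a : finType) (tau : b -> a)
  (tau_inj : injective tau) : measurable_fun setT (rand_map tau_inj).
Proof. exact: measurable_mprod_comp. Qed.

Lemma rand_map_id (a : finType) (id_inj : injective (@id a)) x :
  rand_map id_inj x = x.
Proof. by apply/funext => e; rewrite /rand_map /= imset_id. Qed.

Lemma rand_map_comp (c b a : finType) (tau : c -> b) (sigma : b -> a)
  (tau_inj : injective tau) (sigma_inj : injective sigma)
  (comp_inj : injective (sigma \o tau)) x :
  rand_map comp_inj x = rand_map tau_inj (rand_map sigma_inj x).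
Proof. by apply/funext => e; rewrite /rand_map /= imset_comp. Qed.

Definition rand_structure : borel_data_structure R _ :=
  BDS borel_rand measurable_rand_map rand_map_id rand_map_comp.

Lemma unif_invariant (b a : finType) (tau : b -> a) (tau_inj : injective tau)
    (B : set (rand_structure b)) : measurable B ->
  pushforward (power_prob (@unif01 R) {set a}) (rand_map tau_inj) B =
  power_prob (@unif01 R) {set b} B.
Proof.
move=> mB; rewrite -(power_prob_reindex _ (@imset_inj _ _ _ tau_inj) mB).
by [].
Qed.

Definition unif_law : exchangeable_law rand_structure :=
  @ExchangeableLaw R _ rand_structure
    (fun a => power_prob (@unif01 R) {set a}) unif_invariant.

End randomization_structure.

Definition eq_in_law (R : realType) (I : Type) d (T : measurableType d)
    d1 (Omega : measurableType d1) (P : probability Omega R)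
    (X : I -> Omega -> T)
    d2 (Omega' : measurableType d2) (Q : probability Omega' R)
    (Y : I -> Omega' -> T) : Prop :=
  forall A : set (mprod I T), measurable A ->
    P [set w | A (X ^~ w)] = Q [set w | A (Y ^~ w)].

Definition exchangeable (R : realType) d (T : measurableType d)
    d1 (Omega : measurableType d1) (P : probability Omega R)
    (X : dtuple nat -> {RV P >-> T}) : Prop :=
  forall (pi : nat -> nat) (pi_bij : bijective pi),
    eq_in_law P (fun i => X (dtuple_map (bij_inj pi_bij) i)) P X.

Definition mutually_independent (R : realType) (I : choiceType)
    d (T : measurableType d) d1 (Omega : measurableType d1)
    (P : probability Omega R) (U : I -> {RV P >-> T}) : Prop :=
  forall (J : {fset I}) (B : I -> set T), (forall i, measurable (B i)) ->
    P (\bigcap_(i in [set` J]) (U i @^-1` B i)) =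
    (\prod_(i <- J) P (U i @^-1` B i))%E.

Definition iid_uniform (R : realType) (I : choiceType)
    d1 (Omega : measurableType d1) (P : probability Omega R)
    (U : I -> {RV P >-> unit_itv R}) : Prop :=
  mutually_independent U /\
  forall i (B : set (unit_itv R)), measurable B ->
    distribution P (U i) B = unif01 B.

(* the disjoint union over k of [0,1]^(2^[k]), with 'I_k for [k] *)
Definition cubes (R : realType) : Type :=
  mdsum (fun k : nat => mprod {set 'I_k} (unit_itv R) : measurableType _).

HB.instance Definition _ (R : realType) := Measurable.on (cubes R).

Definition in_cube (R : realType) (k : nat)
    (u : {set 'I_k} -> unit_itv R) : cubes R :=
  existT (fun k => mprod {set 'I_k} (unit_itv R)) k u.

(* pi_i(e), for e a set of positions of the tuple i *)
Definition dtuple_image (M : choiceType) (i : dtuple M)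
    (e : {set 'I_(size (sval i))}) : {fset M} :=
  [fset tnth (in_tuple (sval i)) j | j in e]%fset.

(* Main.v *)
Require Import Defs.
From HB Require Import structures.
From mathcomp Require Import all_boot all_order all_algebra finmap.
From mathcomp Require Import all_classical all_reals all_analysis.
From mathcomp Require Import measurable_realfun lra.
Import Order.TTheory GRing.Theory Num.Theory.

Set Implicit Arguments.
Unset Strict Implicit.
Unset Printing Implicit Defensive.

Local Open Scope classical_set_scope.
Local Open Scope ring_scope.

(** An exchangeable law on arrays is the same thing as the law of an
    exchangeable array over [nat]: finite injections into [nat] extend to
    bijections, so the laws of the finite restrictions of an exchangeable array
    are consistent under all injections; conversely a consistent family has a
    projective limit on the arrays over [nat], by Kolmogorov's theorem.
    Likewise, a natural transformation from the randomization to the arrays is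
    the same thing as a function [f] on the cubes: the entry at a tuple [i] of
    length [k] is, by naturality along [i : 'I_k -> a], the entry at the full
    tuple of ['I_k], whose dependence on the randomization is [f].

    Kolmogorov's theorem is obtained without extending a measure: after a
    coding of the space by bits, the limit law is that of a bit sequence read
    off from one uniform variable by cutting [0, 1] into nested intervals. *)

(** * Kolmogorov's extension theorem *)

Section image_probability.
Context d (S : measurableType d) d' (T : measurableType d') (R : realType).
Context (P : probability S R) (f : S -> T) (mf : measurable_fun setT f).

Definition mfun_of : {mfun S >-> T} :=
  HB.pack f (isMeasurableFun.Build _ _ _ _ f mf).

Definition image_prob : probability T R := distribution P mfun_of.

Lemma image_probE A : image_prob A = P (f @^-1` A).
Proof. by []. Qed.

End image_probability.

(** * Sets depending on finitely many coordinates *)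

Section depends_on.
Context (I : eqType).

Definition depends_on (T : Type) (J : seq I) (A : set (mprod I T)) :=
  forall x y, {in J, x =1 y} -> A x -> A y.

Lemma sub_depends_on T (J K : seq I) (A : set (mprod I T)) :
  {subset J <= K} -> depends_on J A -> depends_on K A.
Proof. by move=> JK dA x y xy; apply: dA => i /JK; exact: xy. Qed.

Lemma depends_onI T (J : seq I) (A B : set (mprod I T)) :
  depends_on J A -> depends_on J B -> depends_on J (A `&` B).
Proof.
by move=> dA dB x y xy [Ax Bx]; split; [exact: dA Ax|exact: dB Bx].
Qed.

(** The measurable sets depending on finitely many coordinates are stable under intersection and
    contain the cylinders, so they form a pi-system generating the product sigma-algebra. *)
Lemma mprod_prob_depends_unique d (T : measurableType d) (R : realType)
    (mu nu : probability (mprod I T) R) :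
  (forall (J : seq I) (A : set (mprod I T)), measurable A -> depends_on J A ->
    mu A = nu A) ->
  forall A, measurable A -> mu A = nu A.
Proof.
move=> munu A mA.
pose G : set (set (mprod I T)) :=
  [set C : set (mprod I T) | measurable C /\ exists J, depends_on J C].
apply: (measure_unique G (fun=> setT)) => //.
- apply/seteqP; split; last first.
    apply: smallest_sub; first exact: sigma_algebra_measurable.
    by move=> C [].
  apply: smallest_sub; first exact: smallest_sigma_algebra.
  move=> _ [i [B mB ->]]; apply: sub_sigma_algebra; split.
    by rewrite -[X in measurable X]setTI; exact: measurable_coord.
  by exists [:: i] => x y /= xy; rewrite xy// mem_head.
- move=> B C [mB [J dB]] [mC [K dC]]; split; first exact: measurableI.
  exists (J ++ K); apply: depends_onI.
    by apply: sub_depends_on dB => i; rewrite mem_cat => ->.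
  by apply: sub_depends_on dC => i; rewrite mem_cat => ->; rewrite orbT.
- by move=> _; split => //; exists [::].
- by rewrite bigcup_const.
- by move=> B [mB [J dB]]; exact: munu dB.
- by move=> _; rewrite (le_lt_trans (probability_le1 _ measurableT))// ltry.
Qed.

End depends_on.

(** * Bit sequences with prescribed weights from one uniform variable *)

Section random_bits.
Context (R : realType).

(** With the latest bit in front, prolonging a prefix is a [cons], so words are treated by
    structural recursion. *)
Definition reversed_prefix (y : nat -> bool) (n : nat) : seq bool :=
  rev (mkseq y n).

Lemma reversed_prefixS y n :
  reversed_prefix y n.+1 = y n :: reversed_prefix y n.
Proof. by rewrite /reversed_prefix mkseqS rev_rcons. Qed.

Lemma size_reversed_prefix y n : size (reversed_prefix y n) = n.
Proof. by rewrite size_rev size_mkseq. Qed.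

Definition bit_cylinder (s : seq bool) : set (mprod nat bool) :=
  [set y | reversed_prefix y (size s) = s].

Lemma bit_cylinder_nil : bit_cylinder [::] = setT.
Proof. by apply/seteqP; split. Qed.

Lemma bit_cylinder_cons b s :
  bit_cylinder (b :: s) = bit_cylinder s `&` [set y | y (size s) = b].
Proof.
apply/seteqP; split => y; rewrite /bit_cylinder /= reversed_prefixS.
  by case=> -> ->.
by case=> -> ->.
Qed.

Lemma bit_cylinder_split s : bit_cylinder s =
  bit_cylinder (false :: s) `|` bit_cylinder (true :: s).
Proof.
rewrite !bit_cylinder_cons -setIUr [X in _ `&` X](_ : _ = setT) ?setIT//.
by apply/seteqP; split => // y _ /=; case: (y _); [right|left].
Qed.

Lemma bit_cylinder_disjoint s :
  bit_cylinder (false :: s) `&` bit_cylinder (true :: s) = set0.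
Proof.
rewrite !bit_cylinder_cons; apply/seteqP; split => // y [[_ /= ->]].
by case.
Qed.

Lemma measurable_bit_cylinder s : measurable (bit_cylinder s).
Proof.
elim: s => [|b s IH]; first by rewrite bit_cylinder_nil.
rewrite bit_cylinder_cons; apply: measurableI => //.
rewrite (_ : [set y | _] =
  (fun y : mprod nat bool => y (size s)) @^-1` [set b])//.
by rewrite -[X in measurable X]setTI; exact: measurable_coord.
Qed.

Lemma bit_cylinder_depends s : depends_on (iota 0 (size s)) (bit_cylinder s).
Proof.
move=> x y xy; rewrite /bit_cylinder /= => <-.
rewrite size_reversed_prefix /reversed_prefix; congr rev.
apply/eq_in_map => i iI.
by rewrite xy//.
Qed.

Context (w : seq bool -> R).
Hypothesis w0 : forall s, 0 <= w s.
Hypothesis w1 : w [::] = 1.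
Hypothesis wD : forall s, w s = w (false :: s) + w (true :: s).

(* Words list the bits from last to first. The word s stands for the
   subinterval of [0, 1] of length w s starting at word_left s, which is cut
   into the intervals of its two extensions. *)
Fixpoint word_left (s : seq bool) : R :=
  if s is b :: s' then
    word_left s' + (if b then w (false :: s') else 0)
  else 0.

Fixpoint word_of (u : R) (n : nat) : seq bool :=
  if n is m.+1 then
    let s := word_of u m in (word_left s + w (false :: s) <= u) :: s
  else [::].

Definition random_bit (u : unit_itv R) : mprod nat bool :=
  fun n => let s := word_of (val u) n in
    word_left s + w (false :: s) <= val u.

Let prefix_random_bit u n :
  reversed_prefix (random_bit u) n = word_of (val u) n.
Proof. by elim: n => [//|n IH]; rewrite reversed_prefixS IH. Qed.

(** Quantifying over real functions [h] avoids a sigma-algebra on words and lets the induction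
    absorb the newest bit into [h]. *)
Let measurable_word_of (h : seq bool -> R) n :
  measurable_fun setT (fun u : unit_itv R => h (word_of (val u) n)).
Proof.
elim: n h => [|n IH] h /=; first exact: measurable_cst.
rewrite (_ : (fun u => _) = (fun u : unit_itv R =>
   let s := word_of (val u) n in
   if word_left s + w (false :: s) <= val u then h (true :: s)
   else h (false :: s))); last by apply/funext => u /=; case: ifP.
apply: measurable_fun_ifT; last 2 first.
- exact: (IH (fun s => h (true :: s))).
- exact: (IH (fun s => h (false :: s))).
apply: measurable_fun_ler; last exact: measurable_unit_val.
exact: (IH (fun s => word_left s + w (false :: s))).
Qed.

Lemma measurable_random_bit : measurable_fun setT random_bit.
Proof.
apply: measurable_mprodP => n.
apply: measurable_fun_ler; last exact: measurable_unit_val.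
exact: (measurable_word_of (fun s => word_left s + w (false :: s))).
Qed.

(** The right endpoint has to be allowed: at [u = 1] every bit read is true, and 1 is the right
    endpoint of the interval of each such word. *)
Let word_of_sub u s : 0 <= u <= 1 -> word_of u (size s) = s ->
  word_left s <= u <= word_left s + w s.
Proof.
move=> u01; elim: s => [|b s IH] /=; first by rewrite add0r w1.
move=> [+ us]; rewrite us => Eb.
have {IH us} := IH us; have := wD s.
by case: b Eb => /=; [|move/negbT; rewrite -ltNge]; lra.
Qed.

Let sub_word_of u s : word_left s < u < word_left s + w s ->
  word_of u (size s) = s.
Proof.
elim: s => [//|b s IH] /= us.
have hs : word_of u (size s) = s.
  apply: IH; move: us; have := wD s.
  have := w0 (false :: s); have := w0 (true :: s).
  by case: b => /=; lra.
rewrite hs; congr cons.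
by case: b us => /= us; [|apply/negbTE; rewrite -ltNge]; lra.
Qed.

Let word_left_itv s : 0 <= word_left s /\ word_left s + w s <= 1.
Proof.
elim: s => [|b s IH] /=; first by rewrite add0r w1; lra.
have := wD s; have := w0 (false :: s); have := w0 (true :: s).
by case: b => /=; lra.
Qed.

Let unif01_itv (a b : R) (x y : bool) : 0 <= a -> a <= b -> b <= 1 ->
  unif01 (val @^-1` [set` Interval (BSide x a) (BSide y b)] : set (unit_itv R))
  = (b - a)%:E.
Proof.
move=> a0 ab b1; rewrite /unif01 (_ : _ @` _ =
    [set` Interval (BSide x a) (BSide y b)]).
  rewrite lebesgue_measure_itv/= lte_fin; case: ltP => [_|ba].
    by rewrite EFinB.
  by congr EFin; apply/eqP; rewrite eq_sym subr_eq0; lra.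
apply/seteqP; split => [_ [u ? <-]//|u ui].
suff u01 : 0 <= u <= 1 by exists (exist _ u u01).
have : u \in `[a, b] by apply: subset_itvScc ui; rewrite bnd_simp.
by rewrite in_itv/=; lra.
Qed.

(** The points that yield the word [s] lie between the open and the closed interval of length [w s]
    starting at [word_left s], and these two have the same measure. *)
Lemma unif01_random_bit s :
  unif01 (random_bit @^-1` bit_cylinder s) = (w s)%:E.
Proof.
have [l0 l1] := word_left_itv s.
have E : random_bit @^-1` bit_cylinder s =
    [set u | word_of (val u) (size s) = s].
  by apply/seteqP; split => u; rewrite /bit_cylinder /= prefix_random_bit.
have mE : measurable (random_bit @^-1` bit_cylinder s).
  rewrite -[X in measurable X]setTI.
  by apply: measurable_random_bit => //; exact: measurable_bit_cylinder.
have mI (i : interval R) : measurable (val @^-1` [set` i] : set (unit_itv R)).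
  rewrite -[X in measurable X]setTI; apply: measurable_unit_val => //.
have lw : word_left s <= word_left s + w s by have := w0 s; lra.
rewrite (_ : w s = word_left s + w s - word_left s); last by lra.
apply/eqP; rewrite eq_le; apply/andP; split.
  rewrite -(unif01_itv true false l0 lw l1).
  apply: le_measure; rewrite ?inE//.
  rewrite E => u /= us; rewrite in_itv/=.
  exact: word_of_sub (valP u) us.
rewrite -(unif01_itv false true l0 lw l1).
apply: le_measure; rewrite ?inE//.
by rewrite E => u /=; rewrite in_itv/=; exact: sub_word_of.
Qed.

End random_bits.

(** * Limits of consistent laws on a countable product *)

Section kolmogorov.
Context (R : realType) (I : countType) d (T : measurableType d).
Hypothesis T_borel : borel_space R T.

(** The eventual probabilities of coded bit cylinders are additive weights on words, so [random_bit]
    realizes them, and decoding its law gives the limit. *)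
Theorem kolmogorov_extension (P : nat -> probability (mprod I T) R) :
  (forall J : seq I, exists N, forall n, (N <= n)%N ->
    forall A, measurable A -> depends_on J A -> P n A = P N A) ->
  exists Q : probability (mprod I T) R,
    forall J : seq I, exists N, forall n, (N <= n)%N ->
    forall A, measurable A -> depends_on J A -> Q A = P n A.
Proof.
move=> /choice[N PN].
have [f [g [mf mg fg]]] : retract T (mprod rat bool).
  exact: retract_trans ((borel_spaceP _ _).1 T_borel) (retract_unit_cantor R).
(* Bit [k] is the bit [q] of coordinate [i] when [k] codes [(i, q)]; a [k] coding no pair gets the
   bit false, which [G] never reads. *)
pose F (x : mprod I T) : mprod nat bool := fun k =>
  if @choice.unpickle (I * rat)%type k is Some p then f (x p.1) p.2 else false.
pose G (y : mprod nat bool) : mprod I T :=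
  fun i => g (fun q => y (choice.pickle (i, q))).
have mF : measurable_fun setT F.
  apply: measurable_mprodP => k; rewrite /F.
  case: (choice.unpickle k) => [[i q]|]; last exact: measurable_cst.
  exact: (measurableT_comp (@measurable_coord rat _ bool q)
    (measurableT_comp mf (@measurable_coord I _ T i))).
have mG : measurable_fun setT G.
  apply: measurable_mprodP => i; rewrite /G.
  exact: (measurableT_comp mg
    (@measurable_mprod_comp nat rat _ bool (fun q => choice.pickle (i, q)))).
have GF x : G (F x) = x.
  apply/funext => i; rewrite /G /F -[RHS]fg; congr g.
  by apply/funext => q; rewrite choice.pickleK.
have mFV A : measurable A -> measurable (F @^-1` A).
  by move=> mA; rewrite -[X in measurable X]setTI; exact: mF.
(* [J_ n] lists the coordinates in [I] that the first [n] bits look at. *)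
pose J_ n : seq I := pmap
  (fun k => omap fst (@choice.unpickle (I * rat)%type k)) (iota 0 n).
have FJ n A : depends_on (iota 0 n) A -> depends_on (J_ n) (F @^-1` A).
  move=> dA x y xy; apply: dA => k kn; rewrite /F.
  case E: (choice.unpickle k) => [[i q]|//] /=; rewrite xy// mem_pmap.
  by apply/mapP; exists k => //; rewrite E.
(* From this index on the probability of the cylinder is constant, and [w s] is that constant. *)
pose w s := fine (P (N (J_ (size s))) (F @^-1` bit_cylinder s)).
have wE s n : (N (J_ (size s)) <= n)%N ->
    P n (F @^-1` bit_cylinder s) = (w s)%:E.
  move=> Nn; rewrite (PN _ _ Nn); last 2 first.
  - apply: mFV; exact: measurable_bit_cylinder.
  - apply: FJ; exact: bit_cylinder_depends.
  by rewrite fineK// fin_num_measure//; apply: mFV;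
    exact: measurable_bit_cylinder.
have wge0 s : 0 <= w s by exact: fine_ge0.
have w1 : w [::] = 1.
  by rewrite /w bit_cylinder_nil preimage_setT probability_setT.
have PD n s : P n (F @^-1` bit_cylinder s) =
    (P n (F @^-1` bit_cylinder (false :: s)) +
     P n (F @^-1` bit_cylinder (true :: s)))%E.
  rewrite {1}bit_cylinder_split preimage_setU measureU//.
  - apply: mFV; exact: measurable_bit_cylinder.
  - apply: mFV; exact: measurable_bit_cylinder.
  - by rewrite -preimage_setI bit_cylinder_disjoint preimage_set0.
have wD s : w s = w (false :: s) + w (true :: s).
  apply: EFin_inj; rewrite EFinD.
  pose n := maxn (N (J_ (size s))) (N (J_ (size s).+1)).
  rewrite -(@wE _ n) ?leq_maxl// PD.
  by rewrite !(@wE (_ :: s) n)// leq_maxr.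
have mb := measurable_random_bit w.
pose nu := image_prob (@unif01 R) mb.
have nuE s : nu (bit_cylinder s) = (w s)%:E.
  exact: unif01_random_bit.
have nuP A n : measurable A -> depends_on (iota 0 n) A ->
    exists M, forall m, (M <= m)%N -> nu A = P m (F @^-1` A).
  move=> mA dA.
  (* Words grow by [k] bits to length [n], where a cylinder lies inside [A] or misses it; the
     cylinder of a shorter word splits into two. *)
  suff H k s : (size s + k = n)%N -> exists M, forall m, (M <= m)%N ->
      nu (A `&` bit_cylinder s) = P m (F @^-1` (A `&` bit_cylinder s)).
    by have := H n [::] erefl; rewrite bit_cylinder_nil setIT.
  elim: k s => [|k IH] s; rewrite ?addn0 => sn.
    have [[y [Ay sy]]|nA] := pselect (A `&` bit_cylinder s !=set0).
      have -> : A `&` bit_cylinder s = bit_cylinder s.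
        apply/seteqP; split => [z []//|z sz]; split => //.
        apply: dA Ay => i; rewrite -sn => si.
        have /(can_inj revK)/eq_in_map :
            reversed_prefix y (size s) = reversed_prefix z (size s).
          by rewrite sy sz.
        exact.
      by exists (N (J_ (size s))) => m Nm; rewrite nuE wE.
    have -> : A `&` bit_cylinder s = set0.
      by apply/seteqP; split => // y Ay; apply: nA; exists y.
    by exists 0%N => m _; rewrite preimage_set0 !measure0.
  have [M0 PM0] := IH (false :: s) (etrans (addSnnS _ _) sn).
  have [M1 PM1] := IH (true :: s) (etrans (addSnnS _ _) sn).
  exists (maxn M0 M1) => m; rewrite geq_max => /andP[M0m M1m].
  have mAs b : measurable (A `&` bit_cylinder (b :: s)).
    by apply: measurableI => //; exact: measurable_bit_cylinder.
  have dAs : (A `&` bit_cylinder (false :: s)) `&`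
             (A `&` bit_cylinder (true :: s)) = set0.
    by rewrite setIACA bit_cylinder_disjoint setI0.
  rewrite bit_cylinder_split setIUr preimage_setU !measureU//.
  - by congr (_ + _)%E; [exact: PM0|exact: PM1].
  - exact: mFV.
  - exact: mFV.
  - by rewrite -preimage_setI dAs preimage_set0.
have mGb : measurable_fun setT (G \o random_bit w) by exact: measurableT_comp.
exists (image_prob (@unif01 R) mGb) => J; exists (N J) => n Nn A mA dA.
(* A set depending on [J] may look at infinitely many bits, so [nuP] does not apply directly.
   Truncation by [tr] keeps the bits of coordinates in [J], and the two truncated laws are compared
   on finitely many bits. *)
pose inJ k := if @choice.unpickle (I * rat)%type k is Some p
              then p.1 \in J else false.
pose tr (y : mprod nat bool) : mprod nat bool := fun k => inJ k && y k.
have mtr : measurable_fun setT tr.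
  apply: measurable_mprodP => k; rewrite /tr; case: (inJ k) => /=.
    exact: measurable_coord.
  exact: measurable_cst.
have mtrV B : measurable B -> measurable (tr @^-1` B).
  by move=> mB; rewrite -[X in measurable X]setTI; exact: mtr.
have mtrF : measurable_fun setT (tr \o F).
  exact: (measurableT_comp mtr mF).
have trF B : depends_on J (F @^-1` (tr @^-1` B)).
  move=> x y xy /=; rewrite (_ : tr (F x) = tr (F y))//.
  apply/funext => k; rewrite /tr /inJ /F.
  case: (choice.unpickle k) => [[i q]|//] /=; case iJ: (i \in J) => //=.
  by rewrite (xy i iJ).
have trE : G @^-1` A = tr @^-1` (G @^-1` A).
  have Gtr y : {in J, G y =1 G (tr y)}.
    move=> i iJ; rewrite /G /tr /inJ; congr g; apply/funext => q.
    by rewrite choice.pickleK iJ.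
  apply/seteqP; split => y; apply: dA => i iJ;
    by rewrite (Gtr y i iJ).
have nu12 := @mprod_prob_depends_unique _ _ _ _
  (image_prob nu mtr) (image_prob (P n) mtrF).
have mGA : measurable (G @^-1` A).
  by rewrite -[X in measurable X]setTI; exact: mG.
transitivity (image_prob nu mtr (G @^-1` A)).
  by rewrite [RHS]image_probE -trE.
rewrite nu12//.
  rewrite image_probE comp_preimage -trE; congr (P n _).
  by apply/seteqP; split => x /=; rewrite GF.
move=> K B mB dB.
change (nu (tr @^-1` B) = P n (F @^-1` (tr @^-1` B))).
have [|M nuM] := nuP (tr @^-1` B) (\max_(k <- K) k).+1 (mtrV B mB).
  move=> x y xy; apply: dB => k kK; rewrite /tr xy//.
  by rewrite mem_iota /= add0n ltnS; apply: leq_bigmax_seq.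
(* Both [maxn M n] and [n] are past [N J], where the law of the coordinates in [J] no longer
   changes. *)
rewrite (nuM (maxn M n)) ?leq_maxl//.
have mFB := mFV _ (mtrV B mB).
rewrite (PN J n Nn _ mFB (trF B)) (PN J (maxn M n) _ _ mFB (trF B))//.
by rewrite (leq_trans Nn)// leq_maxr.
Qed.

(* The n-th law lives on the coordinates F n; down n sends an index to the
   coordinate that represents it, which is meaningful for n large. *)
Corollary projective_limit (F : nat -> Type)
    (p : forall n, probability (mprod (F n) T) R) (down : forall n, I -> F n) :
  (forall J : seq I, exists N, forall n, (N <= n)%N ->
    exists up : F N -> F n, {in J, forall i, down n i = up (down N i)} /\
    forall A : set (mprod (F N) T), measurable A ->
      p n [set x : mprod (F n) T | A (x \o up)] = p N A) ->
  exists Q : probability (mprod I T) R,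
    forall J : seq I, exists N, forall n, (N <= n)%N ->
    forall A : set (mprod I T), measurable A -> depends_on J A ->
      Q A = p n [set x : mprod (F n) T | A (x \o down n)].
Proof.
move=> pJ.
have md n : measurable_fun setT
    (fun x : mprod (F n) T => x \o down n : mprod I T).
  exact: measurable_mprod_comp.
apply: (@kolmogorov_extension (fun n => image_prob (p n) (md n))) => J.
have [N pN] := pJ J; exists N => n /pN[up [upE pup]] A mA dA.
transitivity (p N [set x : mprod (F N) T | A (x \o down N)]) => //.
rewrite -pup; last first.
  by have := md N measurableT A mA; rewrite setTI.
transitivity (p n [set x : mprod (F n) T | A (x \o down n)]) => //.
congr (p n _); apply/seteqP; split => x; apply: dA => i iJ /=;
  by rewrite upE.
Qed.

End kolmogorov.

(** * Independent uniform families *)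

Section infinite_product.
Context (R : realType) (I : countType) d (T : measurableType d).
Hypothesis T_borel : borel_space R T.

(** Projective limit of the finite powers of [P], with index [i] placed at position
    [choice.pickle i]. *)
Lemma infinite_product (P : probability T R) :
  exists Q : probability (mprod I T) R,
    forall (J : {fset I}) (B : I -> set T), (forall i, measurable (B i)) ->
    Q [set x | forall i, i \in J -> B i (x i)] = (\prod_(i <- J) P (B i))%E.
Proof.
(* [inord] sends codes beyond [n] to 0; for large [n] this affects none of finitely many given
   indices. *)
pose down n (i : I) : 'I_n.+1 := inord (choice.pickle i).
have [J|Q QP] := @projective_limit R I d T T_borel (fun n => 'I_n.+1)
    (fun n => power_prob P 'I_n.+1) down.
  exists (\max_(i <- J) choice.pickle i)%N => n Nn.
  exists (widen_ord (Nn : (_ < n.+1)%N)); split => [i iJ|A mA].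
    have iN : (choice.pickle i <= \max_(i <- J) choice.pickle i)%N.
      exact: leq_bigmax_seq.
    apply: val_inj => /=; rewrite !inordK// ltnS//.
    exact: leq_trans iN Nn.
  apply: power_prob_reindex => // i j /(congr1 val) /= ij.
  exact: val_inj.
exists Q => J B mB.
have [N QN] := QP (enum_fset J).
pose n := maxn N (\max_(i <- J) choice.pickle i)%N.
pose s (j : J) : 'I_n.+1 := down n (val j).
have pickle_lt (j : J) : (choice.pickle (val j) < n.+1)%N.
  rewrite ltnS leq_max; apply/orP; right.
  by apply: leq_bigmax_seq => //; exact: valP.
have inj_s : injective s.
  move=> j k /(congr1 val) /=; rewrite !inordK//.
  by move=> /(pcan_inj choice.pickleK)/val_inj.
rewrite (QN n (leq_maxl _ _)); last 2 first.
- rewrite (_ : [set x | _] =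
    \bigcap_(i in [set` J]) ((fun x : mprod I T => x i) @^-1` B i)).
    apply: fin_bigcap_measurable => // i _.
    by rewrite -[X in measurable X]setTI; exact: measurable_coord.
  by apply/seteqP; split.
- by move=> x y xy Ax i iJ; rewrite -xy//; exact: Ax.
transitivity (power_prob P J [set y | forall j : J, B (val j) (y j)]).
  rewrite -(power_prob_reindex P inj_s); last first.
    by apply: (@measurable_box _ _ J (fun j => B (val j))).
  congr (power_prob _ _ _); apply/seteqP; split => x /= Ax.
    by move=> j; exact: (Ax (val j) (valP j)).
  by move=> i iJ; exact: (Ax [` iJ]%fset).
rewrite (@power_prob_box _ _ _ P J (fun j => B (val j)))//.
by rewrite [RHS]big_seq_fsetE.
Qed.

End infinite_product.

Lemma iid_uniform_exists (R : realType) (I : countType) :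
  exists (Q : probability (mprod I (unit_itv R)) R)
    (U : I -> {RV Q >-> unit_itv R}), iid_uniform U.
Proof.
have [Q QP] := infinite_product I (borel_unit_itv R) (@unif01 R).
exists Q, (fun i => mfun_of (@measurable_coord I _ (unit_itv R) i)).
have QU i (B : set (unit_itv R)) : measurable B ->
    Q [set x | B (x i)] = unif01 B.
  move=> mB; have := QP [fset i]%fset (fun=> B) (fun=> mB).
  rewrite big_seq_fset1 => <-; congr (Q _).
  apply/seteqP; split => x /=; first by move=> Bx j; rewrite inE => /eqP ->.
  by apply; rewrite inE.
split => [J B mB|i B mB]; last exact: QU.
rewrite (_ : \bigcap_(i in _) _ =
  [set x : mprod I (unit_itv R) | forall i, i \in J -> B i (x i)]) ?QP//.
by apply: eq_bigr => i _; symmetry; exact: QU.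
Qed.

Section iid_uniform_law.
Context (R : realType) (I : choiceType) d (W : measurableType d).
Context (Q : probability W R) (U : I -> {RV Q >-> unit_itv R}).
Hypothesis iidU : iid_uniform U.

Lemma measurable_family (K : Type) (s : K -> I) :
  measurable_fun setT
    (fun w => (fun k => U (s k) w) : mprod K (unit_itv R)).
Proof. by apply: measurable_mprodP => k; exact: measurable_funPT. Qed.

(** Independence gives the measure of boxes, which determine a law on a finite power; injectivity of
    [s] ensures that no variable occurs twice. *)
Lemma iid_uniform_law (K : finType) (s : K -> I) : injective s ->
  forall A : set (mprod K (unit_itv R)), measurable A ->
  Q [set w | A (fun k => U (s k) w)] = power_prob (@unif01 R) K A.
Proof.
move=> inj_s; apply: (@mprod_prob_unique _ _ _ _
  (image_prob Q (measurable_family s))) => B mB.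
rewrite power_prob_box//.
pose C i := if [pick k | s k == i] is Some k then B k else setT.
have CE k : C (s k) = B k.
  by rewrite /C; case: pickP => [j /eqP/inj_s ->//|/(_ k)]; rewrite eqxx.
have mC i : measurable (C i) by rewrite /C; case: pickP.
transitivity (Q (\bigcap_(i in [set` [fset s k | k in K]%fset])
                   (U i @^-1` C i))).
  congr (Q _); apply/seteqP; split => w /= Bw.
    by move=> _ /= /imfsetP[k _ ->] /=; rewrite CE.
  by move=> k; rewrite -CE; apply: Bw; exact: in_imfset.
rewrite iidU.1// big_imfset/=; last by move=> j k _ _ /inj_s.
rewrite big_enum/=; apply: eq_bigr => k _.
by rewrite CE -(iidU.2 (s k)).
Qed.

End iid_uniform_law.

(** * Exchangeable laws and arrays over the natural numbers *)

(** Built point by point: the bijection so far is followed by the transposition of [p (f j)] and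
    [g j], which by injectivity fixes the values already correct. *)
Lemma injections_conjugate (b : finType) (f g : b -> nat) :
  injective f -> injective g ->
  exists2 p : nat -> nat, bijective p & forall j, p (f j) = g j.
Proof.
move=> inj_f inj_g.
suff [p pb pE] : exists2 p : nat -> nat, bijective p &
    {in enum b, forall j, p (f j) = g j}.
  by exists p => // j; apply: pE; rewrite mem_enum.
elim: (enum b) (enum_uniq b) => [|j l IH] /=.
  by move=> _; exists id => //; exists id.
move=> /andP[jl /IH[p pb pE]].
pose x := p (f j); pose y := g j.
pose t k := if k == x then y else if k == y then x else k.
have tK : involutive t.
  move=> k; rewrite /t; have [->|kx] := eqVneq k x.
    by rewrite eqxx; case: eqVneq.
  have [->|ky] := eqVneq k y; first by rewrite eqxx.
  by rewrite (negbTE kx) (negbTE ky).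
exists (t \o p); first by apply: bij_comp => //; exact: inv_bij.
move=> k; rewrite inE => /orP[/eqP -> /=|kl /=]; first by rewrite /t eqxx.
have kj : k != j by apply: contraNneq jl => <-.
rewrite (pE k kl) /t ifN; last first.
  by rewrite -(pE k kl) /x (inj_eq (bij_inj pb)) (inj_eq inj_f).
by rewrite ifN// (inj_eq inj_g).
Qed.

(** * Tuples of natural numbers with bounded entries *)

HB.instance Definition _ (M : countType) :=
  Countable.copy (dtuple M) {s : seq M | uniq s}.

Definition below (n : nat) (s : seq nat) := all (ltn^~ n) s.

(** Entries that are at least [n] are dropped, which makes the map total; it is meant for tuples
    [below n]. *)
Definition restrict_dtuple (n : nat) (s : dtuple nat) : dtuple 'I_n :=
  exist _ (pmap insub (sval s)) (pmap_sub_uniq _ (svalP s)).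

Lemma restrict_dtupleK n (s : dtuple nat) : below n (sval s) ->
  dtuple_map val_inj (restrict_dtuple n s) = s.
Proof.
move=> ns; apply: val_inj => /=; rewrite pmap_filter.
  by apply/all_filterP/allP => i /(allP ns) in_; rewrite insubT.
exact: insubK.
Qed.

Lemma dtuple_map_comp (L M N : eqType) (f : L -> M) (g : M -> N)
    (inj_f : injective f) (inj_g : injective g)
    (inj_gf : injective (g \o f)) (s : dtuple L) :
  dtuple_map inj_gf s = dtuple_map inj_g (dtuple_map inj_f s).
Proof. by apply: val_inj; rewrite /= map_comp. Qed.

Lemma dtuple_map_inj (M N : eqType) (f : M -> N) (inj_f : injective f) :
  injective (dtuple_map inj_f).
Proof.
by move=> s t /(congr1 sval) /= /(inj_map inj_f) st; exact: val_inj.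
Qed.

Lemma seq_dtuple_below (J : seq (dtuple nat)) :
  exists N, forall n, (N <= n)%N -> {in J, forall s, below n (sval s)}.
Proof.
exists (\max_(s <- J) \max_(i <- sval s) i).+1 => n Nn s sJ.
apply/allP => i si; apply: leq_trans Nn; rewrite ltnS.
apply: (@leq_trans (\max_(i <- sval s) i)); first exact: leq_bigmax_seq.
exact: (leq_bigmax_seq (F := fun s : dtuple nat => \max_(i <- sval s) i)).
Qed.

(** * From exchangeable laws to arrays over [nat] *)

Section array_limit.
Context (R : realType) d (X : measurableType d) (X_borel : borel_space R X).
Context (mu : exchangeable_law (array_structure X_borel)).

(** The laws over ['I_n] are consistent under inclusions and have a projective limit. Any injection
    [tau] factors through some ['I_n], where invariance of [mu] identifies the law. *)
Lemma array_limit : exists Q : probability (mprod (dtuple nat) X) R,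
  forall (a : finType) (tau : a -> nat) (tau_inj : injective tau)
    (B : set (mprod (dtuple a) X)), measurable B ->
  Q [set x : mprod (dtuple nat) X | B (x \o dtuple_map tau_inj)] = mu a B.
Proof.
have [J|Q QP] := @projective_limit R (dtuple nat) d X X_borel
    (fun n => dtuple 'I_n) (fun n => mu 'I_n) restrict_dtuple.
  have [N JN] := seq_dtuple_below J; exists N => n Nn.
  have wi : injective (widen_ord Nn) by move=> i j /(congr1 val) /= /val_inj.
  exists (dtuple_map wi); split => [s sJ|A mA]; last first.
    exact: (law_invariant mu wi).
  apply: (@dtuple_map_inj _ _ val val_inj).
  rewrite restrict_dtupleK; last exact: JN sJ.
  rewrite -[LHS](restrict_dtupleK (JN N (leqnn N) s sJ)).
  by apply: val_inj => /=; rewrite -map_comp.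
exists Q => a tau tau_inj.
have mtau : measurable_fun setT
    (fun x : mprod (dtuple nat) X =>
      x \o dtuple_map tau_inj : mprod (dtuple a) X).
  exact: measurable_mprod_comp.
apply: (@mprod_prob_depends_unique _ _ _ _ (image_prob Q mtau) (mu a)).
move=> J A mA dA; change (Q [set x : mprod (dtuple nat) X |
  A (x \o dtuple_map tau_inj)] = mu a A).
have [N QN] := QP [seq dtuple_map tau_inj s | s <- J].
(* Past the index valid for the tuples in play, and above all values of [tau]. *)
pose n := maxn N (\max_(j : a) tau j).+1.
have tau_lt j : (tau j < n)%N.
  by rewrite /n leq_max ltnS (leq_bigmax j) orbT.
pose taun j := Ordinal (tau_lt j).
have taun_inj : injective taun by move=> i j /(congr1 val)/tau_inj.
rewrite (QN n (leq_maxl _ _)); last 2 first.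
- by have := mtau measurableT A mA; rewrite setTI.
- by move=> x y xy; apply: dA => s sJ /=; rewrite xy// map_f.
rewrite -(law_invariant mu taun_inj)//.
congr (mu _ _); apply/seteqP.
suff E (x : mprod (dtuple 'I_n) X) :
    (x \o restrict_dtuple n) \o dtuple_map tau_inj = array_map taun_inj x.
  by split => x /=; rewrite E.
apply/funext => s /=; rewrite /array_map /=; congr x.
apply: (@dtuple_map_inj _ _ val val_inj).
rewrite restrict_dtupleK; first by apply: val_inj; rewrite /= -map_comp.
by apply/allP => _ /mapP[j _ ->] /=; exact: tau_lt.
Qed.

(** On tuples with entries below [n], the array and its permuted version are read along the
    injections [val] and [p \o val], so both have law [mu 'I_n]. *)
Lemma array_limit_exchangeable (Q : probability (mprod (dtuple nat) X) R) :
  (forall (a : finType) (tau : a -> nat) (tau_inj : injective tau)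
    (B : set (mprod (dtuple a) X)), measurable B ->
    Q [set x : mprod (dtuple nat) X | B (x \o dtuple_map tau_inj)] = mu a B) ->
  @exchangeable R d X _ _ Q (fun i => mfun_of (@measurable_coord _ _ X i)).
Proof.
move=> QP p p_bij.
have mp : measurable_fun setT (fun x : mprod (dtuple nat) X =>
    x \o dtuple_map (bij_inj p_bij) : mprod (dtuple nat) X).
  exact: measurable_mprod_comp.
apply: (@mprod_prob_depends_unique _ _ _ _ (image_prob Q mp) Q) => J A mA dA.
change (Q [set x : mprod (dtuple nat) X |
  A (x \o dtuple_map (bij_inj p_bij))] = Q A).
have [n Jn] := seq_dtuple_below J.
pose A' := [set y : mprod (dtuple 'I_n) X | A (y \o restrict_dtuple n)].
have mA' : measurable A'.
  have := @measurable_mprod_comp _ _ _ X (restrict_dtuple n) measurableT A mA.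
  by rewrite setTI.
have inj_pval : injective (p \o val : 'I_n -> nat).
  exact: inj_comp (bij_inj p_bij) val_inj.
transitivity (mu 'I_n A').
  rewrite -(QP _ _ inj_pval)//; congr (Q _); apply/seteqP.
  split => x; apply: dA => s sJ /=; congr x;
    by rewrite (dtuple_map_comp val_inj (bij_inj p_bij)) restrict_dtupleK//
      (Jn n).
rewrite -(QP _ val val_inj)//; congr (Q _); apply/seteqP.
by split => x; apply: dA => s sJ /=; rewrite restrict_dtupleK// (Jn n).
Qed.

End array_limit.

(** * From arrays over [nat] to exchangeable laws *)

Section array_law.
Context (R : realType) d (X : measurableType d) (X_borel : borel_space R X).
Context d1 (W : measurableType d1) (P : probability W R).
Context (xi : dtuple nat -> {RV P >-> X}).

Let measurable_restriction (a : finType) (tau : a -> nat)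
    (tau_inj : injective tau) : measurable_fun setT
  (fun w => (fun i => xi (dtuple_map tau_inj i) w) : mprod (dtuple a) X).
Proof. by apply: measurable_mprodP => i; exact: measurable_funPT. Qed.

Hypothesis xi_exch : exchangeable xi.

(** A bijection of [nat] carrying [f] to [g] turns one restriction into the other. *)
Lemma exchangeable_injections (a : finType) (f g : a -> nat)
    (inj_f : injective f) (inj_g : injective g)
    (B : set (mprod (dtuple a) X)) : measurable B ->
  P [set w | B (fun i => xi (dtuple_map inj_f i) w)] =
  P [set w | B (fun i => xi (dtuple_map inj_g i) w)].
Proof.
move=> mB; have [p p_bij pfg] := injections_conjugate inj_f inj_g.
pose A := [set x : mprod (dtuple nat) X | B (x \o dtuple_map inj_f)].
have mA : measurable A.
  have := @measurable_mprod_comp _ _ _ X (dtuple_map inj_f) measurableT B mB.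
  by rewrite setTI.
have := xi_exch p_bij mA; rewrite /A /= => <-.
congr (P _); apply/seteqP.
suff E w : (fun i => xi (dtuple_map (bij_inj p_bij) i) w) \o dtuple_map inj_f =
    (fun i => xi (dtuple_map inj_g i) w).
  by split => w /=; rewrite E.
apply/funext => i /=; congr (xi _ w).
by apply: val_inj; rewrite /= -map_comp; apply: eq_map => j /=; rewrite pfg.
Qed.

(** The law on a finite set is defined through its numbering by [enum_rank]; by
    [exchangeable_injections] every other injection into [nat] gives the same law. *)
Lemma exchangeable_array_law :
  exists mu : exchangeable_law (array_structure X_borel),
  forall (a : finType) (tau : a -> nat) (tau_inj : injective tau)
    (B : set (mprod (dtuple a) X)), measurable B ->
  mu a B = P [set w | B (fun i => xi (dtuple_map tau_inj i) w)].
Proof.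
have inj_rank (a : finType) : injective (fun j : a => enum_rank j : nat).
  by move=> i j /val_inj/enum_rank_inj.
pose mu_ (a : finType) : probability (array_structure X_borel a) R :=
  image_prob P (measurable_restriction (@inj_rank a)).
have mu_inv (b a : finType) (tau : b -> a) (tau_inj : injective tau)
    (B : set (array_structure X_borel b)) : measurable B ->
    pushforward (mu_ a) (bds_map tau_inj) B = mu_ b B.
  move=> mB; have inj' := inj_comp (@inj_rank a) tau_inj.
  transitivity (P [set w | B (fun i => xi (dtuple_map inj' i) w)]).
    congr (P _); apply/seteqP.
    suff E w : array_map tau_inj
        (fun i => xi (dtuple_map (@inj_rank a) i) w) =
        (fun i => xi (dtuple_map inj' i) w).
      by split => w; rewrite /= E.
    apply/funext => i; rewrite /array_map /=; congr (xi _ w).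
    by rewrite (dtuple_map_comp tau_inj (@inj_rank a)).
  exact: exchangeable_injections.
exists (ExchangeableLaw mu_inv) => a tau tau_inj B mB.
exact: exchangeable_injections.
Qed.

End array_law.

(** * Natural transformations and functions on cubes *)

Section cubes.
Context (R : realType).

(** Lengths that are only provably equal give cubes of different types; a family [h] uniform in the
    length lets the equation be stated in the sum [cubes]. *)
Lemma in_cube_tnth (M : Type) n (t : n.-tuple M) (s : seq M)
    (h : forall k, ('I_k -> M) -> {set 'I_k} -> unit_itv R) :
  tval t = s ->
  in_cube (h n (tnth t)) = in_cube (h (size s) (tnth (in_tuple s))).
Proof.
case: t => t tn /= <-; have := eqP tn; move: (n) tn => m + E; rewrite -E => tm.
by congr (in_cube (h _ (tnth _))); exact: val_inj.
Qed.

(** The argument of [f] in the representation, over a finite index set. *)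
Definition tuple_cube (a : finType) (i : dtuple a)
    (u : mprod {set a} (unit_itv R)) : cubes R :=
  in_cube (fun e : {set 'I_(size (sval i))} =>
    u [set tnth (in_tuple (sval i)) j | j in e]%SET).

Lemma measurable_tuple_cube (a : finType) (i : dtuple a) :
  measurable_fun setT (tuple_cube i).
Proof.
move=> _ B mB; rewrite setTI.
have := @measurable_mprod_comp {set a} {set 'I_(size (sval i))} _ (unit_itv R)
  (fun e => [set tnth (in_tuple (sval i)) j | j in e]%SET) measurableT
  _ (mB (size (sval i))).
by rewrite setTI.
Qed.

Lemma tuple_cube_natural (a b : finType) (tau : b -> a)
    (tau_inj : injective tau) (i : dtuple b) u :
  tuple_cube i (rand_map tau_inj u) = tuple_cube (dtuple_map tau_inj i) u.
Proof.
rewrite /tuple_cube /=.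
rewrite -(@in_cube_tnth _ _ (map_tuple tau (in_tuple (sval i))) _
  (fun k g e => u [set g j | j in e]%SET))//.
congr in_cube; apply/funext => e; rewrite /rand_map -imset_comp; congr u.
by apply: eq_imset => j /=; rewrite tnth_map.
Qed.

(** Passes from variables indexed by finite subsets of [N] to a randomization indexed by subsets of
    [a]. *)
Lemma dtuple_image_cube (a : finType) (N : choiceType) (tau : a -> N)
    (tau_inj : injective tau) (i : dtuple a) (u : {fset N} -> unit_itv R) :
  in_cube (fun e => u (dtuple_image (i := dtuple_map tau_inj i) e)) =
  tuple_cube i (fun e => u [fset tau j | j in e]%fset).
Proof.
rewrite /tuple_cube /dtuple_image /=.
rewrite -(@in_cube_tnth _ _ (map_tuple tau (in_tuple (sval i))) _
  (fun k g e => u [fset g j | j in e]%fset))//.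
congr in_cube; apply/funext => e; congr u; apply/fsetP => x.
apply/imfsetP/imfsetP => -[j /= je ->].
  by exists (tnth (in_tuple (sval i)) j); [exact: imset_f|rewrite tnth_map].
by case/imsetP: je => k ke ->; exists k => //; rewrite tnth_map.
Qed.

(** Provides the injectivity asked by [iid_uniform_law]: distinct subsets of [a] receive distinct
    variables. *)
Lemma fset_image_inj (a : finType) (N : choiceType) (tau : a -> N) :
  injective tau -> injective (fun e : {set a} => [fset tau j | j in e]%fset).
Proof.
move=> tau_inj e e' /fsetP ee'; apply/setP => j.
have memE (c : {set a}) : (tau j \in [fset tau k | k in c]%fset) = (j \in c).
  apply/imfsetP/idP => [[k /= kc /tau_inj ->//]|jc]; by exists j.
by rewrite -!memE ee'.
Qed.

End cubes.

Section transformations_and_functions.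
Context (R : realType) (d : measure_display) (X : measurableType d).
Context (X_borel : borel_space R X).

Section transformation_of_function.
Context (f : cubes R -> X) (mf : measurable_fun [set: cubes R] f).

Definition array_of (a : finType) (u : rand_structure R a) :
  array_structure X_borel a := fun i => f (tuple_cube i u).

Lemma measurable_array_of (a : finType) : measurable_fun setT (@array_of a).
Proof.
apply: measurable_mprodP => i.
exact: (measurableT_comp mf (measurable_tuple_cube i)).
Qed.

Lemma array_of_natural (b a : finType) (tau : b -> a)
    (tau_inj : injective tau) x :
  array_of (bds_map tau_inj x) = bds_map tau_inj (array_of x).
Proof.
by apply/funext => i; rewrite /array_of tuple_cube_natural.
Qed.

Definition transformation_of_function :=
  NaturalTransformation measurable_array_of array_of_natural.

End transformation_of_function.

Section function_of_transformation.
Context (eta : natural_transformation (rand_structure R)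
                                      (array_structure X_borel)).

Definition full_dtuple (a : finType) : dtuple a :=
  exist _ (enum a) (enum_uniq a).

Definition function_of_transformation (c : cubes R) : X :=
  let: existT k u := c in eta 'I_k u (full_dtuple 'I_k).

Lemma measurable_function_of_transformation :
  measurable_fun [set: cubes R] function_of_transformation.
Proof.
apply/measurable_mdsumP => k.
have mc : measurable_fun setT
    (fun x : mprod (dtuple 'I_k) X => x (full_dtuple 'I_k)).
  exact: measurable_coord.
exact: (measurableT_comp mc (@nat_measurable _ _ _ _ _ eta 'I_k)).
Qed.

Lemma function_of_transformationE (a : finType) (i : dtuple a)
    (u : rand_structure R a) :
  function_of_transformation (tuple_cube i u) = eta a u i.
Proof.
(* Distinctness of the entries makes naturality along [i] available; it carries the full tuple to
   [i]. *)
have inj_i : injective (tnth (in_tuple (sval i))).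
  exact/tuple_uniqP/(svalP i).
rewrite /= (nat_natural eta inj_i u); congr (eta a u).
by apply: val_inj; rewrite /= map_tnth_enum.
Qed.

End function_of_transformation.

End transformations_and_functions.

(** * Equivalence of the two representations *)

Theorem theorem2 (R : realType) (d : measure_display) (X : measurableType d)
    (X_borel : borel_space R X) :
  (forall (d1 : measure_display) (Omega : measurableType d1)
      (P : probability Omega R) (xi : dtuple nat -> {RV P >-> X}),
    exchangeable xi ->
    exists f : cubes R -> X, measurable_fun [set: cubes R] f /\
    exists (d2 : measure_display) (Omega' : measurableType d2)
        (Q : probability Omega' R) (U : {fset nat} -> {RV Q >-> unit_itv R}),
      iid_uniform U /\
      eq_in_law P xi Q
        (fun i w => f (in_cube (fun e => U (dtuple_image (i := i) e) w))))
  <->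
  (forall mu : exchangeable_law (array_structure X_borel),
    exists eta : natural_transformation (rand_structure R)
                                        (array_structure X_borel),
    forall (a : finType) (B : set (array_structure X_borel a)), measurable B ->
      mu a B = pushforward (unif_law R a) (@nat_fun _ _ _ _ _ eta a) B).
Proof.
split=> [represent mu|represent d1 Omega P xi xi_exch].
(* Under the limit law the coordinate maps form an exchangeable array; the [f] representing it
   yields the transformation. *)
- have [P Pmu] := array_limit mu.
  have [f [mf [d2 [W [Q [U [iidU PQ]]]]]]] :=
    represent _ _ _ _ (array_limit_exchangeable Pmu).
  exists (transformation_of_function X_borel mf) => a B mB.
  have tau_inj : injective (fun j : a => enum_rank j : nat).
    by move=> i j /val_inj/enum_rank_inj.
  rewrite -(Pmu a _ tau_inj B mB).
  pose A := [set x : mprod (dtuple nat) X | B (x \o dtuple_map tau_inj)].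
  have mA : measurable A.
    have := @measurable_mprod_comp _ _ _ X (dtuple_map tau_inj)
      measurableT B mB.
    by rewrite setTI.
  rewrite (PQ A mA).
  have mB' : measurable (@array_of R d X X_borel f a @^-1` B).
    by have := @measurable_array_of R d X X_borel f mf a measurableT _ mB;
      rewrite setTI.
  rewrite [RHS](_ : _ = power_prob (@unif01 R) {set a}
    (@array_of R d X X_borel f a @^-1` B))//.
  rewrite -(iid_uniform_law iidU (fset_image_inj tau_inj) mB').
  congr (Q _); apply/seteqP.
  suff E w : (fun i => f (in_cube (fun e => U (dtuple_image (i := i) e) w))) \o
      dtuple_map tau_inj =
    array_of X_borel f (fun e : {set a} =>
      U [fset (enum_rank j : nat) | j in e]%fset w).
    by split => w; rewrite /A /= E.
  apply/funext => i /=; rewrite /array_of; congr f.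
  exact: (dtuple_image_cube tau_inj i (fun e => U e w)).
- have [mu muP] := exchangeable_array_law X_borel xi_exch.
  have [eta etaP] := represent mu.
  have [Q [U iidU]] := iid_uniform_exists R {fset nat}.
  exists (function_of_transformation eta).
  split; first exact: measurable_function_of_transformation.
  exists _, _, Q, U; split => //.
  pose Y w : mprod (dtuple nat) X := fun i => function_of_transformation eta
    (in_cube (fun e => U (dtuple_image (i := i) e) w)).
  (* The randomization of ['I_n] contained in [U]; it determines the entries of [Y] at tuples below
     [n]. *)
  pose un n w : mprod {set 'I_n} (unit_itv R) :=
    fun e => U [fset val j | j in e]%fset w.
  have YE n s w : below n (sval s) ->
      Y w s = eta 'I_n (un n w) (restrict_dtuple n s).
    move=> ns; rewrite -{1}(restrict_dtupleK ns) -function_of_transformationE.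
    congr (function_of_transformation eta).
    exact: (dtuple_image_cube val_inj _ (fun e => U e w)).
  have mxi : measurable_fun setT
      (fun w => xi ^~ w : mprod (dtuple nat) X).
    by apply: measurable_mprodP => i; exact: measurable_funPT.
  have mY : measurable_fun setT Y.
    apply: measurable_mprodP => s.
    have [n /(_ n (leqnn n))/(_ s (mem_head _ _)) ns] :=
      seq_dtuple_below [:: s].
    rewrite (_ : (fun w => Y w s) =
      (fun x : mprod (dtuple 'I_n) X => x (restrict_dtuple n s)) \o
      (eta 'I_n \o un n)); last by apply/funext => w; exact: YE.
    have mun : measurable_fun setT (un n) by exact: measurable_family.
    exact: (measurableT_comp (@measurable_coord _ _ X (restrict_dtuple n s))
      (measurableT_comp (@nat_measurable _ _ _ _ _ eta 'I_n) mun)).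
  apply: (@mprod_prob_depends_unique _ _ _ _
    (image_prob P mxi) (image_prob Q mY)) => J A mA dA.
  (* With all tuples of [J] below [n], both arrays are compared over ['I_n], where each side equals
     [mu 'I_n A']. *)
  have [n /(_ n (leqnn n)) Jn] := seq_dtuple_below J.
  pose A' := [set y : mprod (dtuple 'I_n) X | A (y \o restrict_dtuple n)].
  have mA' : measurable A'.
    have := @measurable_mprod_comp _ _ _ X (restrict_dtuple n) measurableT A mA.
    by rewrite setTI.
  have meA' : measurable (eta 'I_n @^-1` A').
    by have := @nat_measurable _ _ _ _ _ eta 'I_n measurableT _ mA';
      rewrite setTI.
  transitivity (mu 'I_n A').
    rewrite (muP _ val val_inj)//; congr (P _); apply/seteqP.
    by split => w; apply: dA => s sJ /=; rewrite restrict_dtupleK// Jn.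
  rewrite etaP//.
  transitivity (power_prob (@unif01 R) {set 'I_n} (eta 'I_n @^-1` A')) => //.
  rewrite -(iid_uniform_law iidU (fset_image_inj (@val_inj _ _ 'I_n)) meA').
  congr (Q _); apply/seteqP; split => w; apply: dA => s sJ.
    by symmetry; exact: YE (Jn s sJ).
  exact: YE (Jn s sJ).
Qed.
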